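(* Let $\mathbb{C}$ be a modified category of interest and let $(C_1,C_0,\partial)$ be a crossed module in $\mathbb{C}$. Then the center $Z(C_1,C_0,\partial)=(Z_1,Z_0,\partial|)$ is the maximal central subobject (in the sense of Huq) of $(C_1,C_0,\partial)$ in the category of crossed modules in $\mathbb{C}$.
   Context: **Modified category of interest.** Let $\mathbb{C}$ be a category of groups with a set of operations $\Omega$ and a set of identities $\mathbb{E}$ (objects are the algebras with operations $\Omega$ satisfying $\mathbb{E}$, morphisms are the maps preserving all operations), where $\mathbb{E}$ includes the group identities. Let $\Omega_i$ be the set of $i$-ary operations in $\Omega$. $\mathbb{C}$ is a modified category of interest if: (a) $\Omega=\Omega_0\cup\Omega_1\cup\Omega_2$; (b) the group operations, written additively $0,-,+$ (the group need not be commutative), are elements of $\Omega_0,\Omega_1,\Omega_2$ respectively; with $\Omega_2'=\Omega_2\setminus\{+\}$ and $\Omega_1'=\Omega_1\setminus\{-\}$, if $\ast\in\Omega_2'$ then $\Omega_2'$ contains $\ast^\circ$ defined by $x\ast^\circ y=y\ast x$; and $\Omega_0=\{0\}$; (c) for each $\ast\in\Omega_2'$, $\mathbb{E}$ includes $x\ast(y+z)=x\ast y+x\ast z$; (d) for each $\omega\in\Omega_1'$ and $\ast\in\Omega_2'$, $\mathbb{E}$ includes $\omega(x+y)=\omega(x)+\omega(y)$ and $\omega(x\ast y)=\omega(x)\ast\omega(y)$; and for every object $C$ and $x_1,x_2,x_3\in C$: (Axiom 1) $x_1+(x_2\ast x_3)=(x_2\ast x_3)+x_1$ for each $\ast\in\Omega_2'$;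 (Axiom 2) for each ordered pair $(\ast,\overline{\ast})\in\Omega_2'\times\Omega_2'$ there is a word $W$ such that $(x_1\ast x_2)\overline{\ast}x_3=W(x_1(x_2x_3),x_1(x_3x_2),(x_2x_3)x_1,(x_3x_2)x_1,x_2(x_1x_3),x_2(x_3x_1),(x_1x_3)x_2,(x_3x_1)x_2)$, where each juxtaposition represents an operation in $\Omega_2'$. **Derived actions.** For a split extension $0\to A\to E\xrightarrow{p}B\to 0$ in $\mathbb{C}$ with section $s:B\to E$ (a morphism with $ps=1_B$), the associated derived action of $B$ on $A$ consists of the maps $b\cdot a=s(b)+a-s(b)$ and $b\ast a=s(b)\ast a$ for $a\in A$, $b\in B$, $\ast\in\Omega_2'$ (with $a\ast b$ meaning $b\ast^\circ a$). A derived action of $B$ on $A$ is a set of maps arising in this way from some split extension. **Crossed modules.** A crossed module in $\mathbb{C}$ is a triple $(C_1,C_0,\partial)$ where $C_0,C_1\in\mathbb{C}$, $C_0$ has a derived action on $C_1$, and $\partial:C_1\to C_0$ is a morphism in $\mathbb{C}$ such that for all $c_0\in C_0$, $c_1,c_1'\in C_1$, $\ast\in\Omega_2'$: $\partial(c_0\cdot c_1)=c_0+\partial(c_1)-c_0$, $\partial(c_0\ast c_1)=c_0\ast\partial(c_1)$, $\partial(c_1)\cdot c_1'=c_1+c_1'-c_1$, $\partial(c_1)\ast c_1'=c_1\ast c_1'$. A morphism $(C_1,C_0,\partial)\to(C_1',C_0',\partial')$ is a pair $(\mu_1,\mu_0)$ of $\mathbb{C}$-morphisms $\mu_i:C_i\to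 C_i'$ with $\mu_0\partial=\partial'\mu_1$, $\mu_1(c_0\cdot c_1)=\mu_0(c_0)\cdot\mu_1(c_1)$ and $\mu_1(c_0\ast c_1)=\mu_0(c_0)\ast\mu_1(c_1)$ for all $c_0,c_1$ and $\ast\in\Omega_2'$. The direct product of two crossed modules is formed componentwise. **Center of a crossed module.** For a crossed module $(C_1,C_0,\partial)$, its center is $Z(C_1,C_0,\partial)=(Z_1,Z_0,\partial|)$ (with $\partial|$ the restriction of $\partial$ to $Z_1$ and the induced action), where $Z_1=\{z_1\in C_1\mid z_1+c_1=c_1+z_1,\ c_0+\partial(z_1)=\partial(z_1)+c_0,\ c_0\cdot z_1=z_1,\ c_1\ast z_1=0,\ c_0\ast z_1=0\ \text{for all } c_0\in C_0,\ c_1\in C_1,\ \ast\in\Omega_2'\}$ and $Z_0=\{z_0\in C_0\mid z_0\cdot c_1=c_1,\ z_0+c_0=c_0+z_0,\ c_1\ast z_0=0,\ c_0\ast z_0=0\ \text{for all } c_0\in C_0,\ c_1\in C_1,\ \ast\in\Omega_2'\}$. **Central subobjects (Huq).** Two morphisms $\beta_1:B_1\to A$ and $\beta_2:B_2\to A$ commute if there is a morphism $\beta_1\circ\beta_2:B_1\times B_2\to A$ with $(\beta_1\circ\beta_2)\Gamma_i=\beta_i$ for $i=1,2$, where $\Gamma_i:B_i\to B_1\times B_2$ are the canonical injections into the direct product. A morphism $\beta:B\to A$ is central if it commutes with the identity morphism $1_A$. If in addition $\beta$ is a monomorphism, then $B$ is called a central subobject of $A$. The maximal central subobject is the largest one relative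 to the order relation on monomorphisms into $A$ (factorization).
   Formalization: The formal theorem assumes in addition that Z_1 and Z_0 are preserved by every unary operation ω in Ω_1'; without this the center need not be an object of the category (e.g. C_1=0, C_0=Z/2×S_3, ω(a,h)=(0,f(a)), f injective, Ω_2' empty). *)

(* Defs.v *)
From Corelib Require Import ssreflect ssrfun.
From Stdlib Require Import ProofIrrelevance.

Set Implicit Arguments.
Unset Strict Implicit.
Unset Printing Implicit Defensive.

Declare Scope alg_scope.
Delimit Scope alg_scope with A.
Declare Scope term_scope.
Delimit Scope term_scope with T.

(* Only the non-group operations are listed: [una_op] is Omega_1', [bin_op] is
   Omega_2' and [dual] sends an operation to its opposite.  The operations
   0, -, + are built into terms and algebras, and 0 is the only constant. *)
Record signature := Signature {
  una_op : Type;
  bin_op : Type;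
  dual : bin_op -> bin_op
}.

Inductive term (S : signature) (V : Type) : Type :=
| Var (v : V)
| TZero
| TOpp (t : term S V)
| TAdd (t u : term S V)
| TUna (w : una_op S) (t : term S V)
| TBin (o : bin_op S) (t u : term S V).

Arguments Var {S V} v.
Arguments TZero {S V}.

Notation "0" := TZero : term_scope.
Notation "- t" := (TOpp t) : term_scope.
Notation "t + u" := (TAdd t u) : term_scope.
Notation "t *[ o ] u" := (TBin o t u)
  (at level 40, o at level 200, left associativity) : term_scope.
Bind Scope term_scope with term.

Record algebra (S : signature) := Algebra {
  carrier :> Type;
  zero : carrier;
  opp : carrier -> carrier;
  add : carrier -> carrier -> carrier;
  una : una_op S -> carrier -> carrier;
  bin : bin_op S -> carrier -> carrier -> carrier
}.

Arguments zero {S a}.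

Notation "0" := zero : alg_scope.
Notation "- x" := (opp x) : alg_scope.
Notation "x + y" := (add x y) : alg_scope.
Notation "x - y" := (add x (opp y)) : alg_scope.
Notation "x *[ o ] y" := (bin o x y)
  (at level 40, o at level 200, left associativity) : alg_scope.
Bind Scope alg_scope with carrier.
Local Open Scope alg_scope.

Fixpoint eval (S : signature) (A : algebra S) (V : Type) (e : V -> A)
    (t : term S V) : A :=
  match t with
  | Var v => e v
  | TZero => 0
  | TOpp t => - eval e t
  | TAdd t u => eval e t + eval e u
  | TUna w t => una w (eval e t)
  | TBin o t u => eval e t *[o] eval e u
  end.

Definition models (S : signature) (E : term S nat -> term S nat -> Prop)
    (A : algebra S) : Prop :=
  forall t u, E t u -> forall e : nat -> A, eval e t = eval e u.

(* The eight kinds of arguments of the word [W] in Axiom 2. *)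
Inductive shape :=
| x1_x2x3 | x1_x3x2 | x2x3_x1 | x3x2_x1
| x2_x1x3 | x2_x3x1 | x1x3_x2 | x3x1_x2.

(* Every juxtaposition stands for an operation of its own: [o] is the outer one
   and [o'] the inner one.  A word may use one shape with several pairs of
   operations. *)
Definition shape_val (S : signature) (A : algebra S) (x1 x2 x3 : A)
    (s : shape * bin_op S * bin_op S) : A :=
  let: (k, o, o') := s in
  match k with
  | x1_x2x3 => x1 *[o] (x2 *[o'] x3)
  | x1_x3x2 => x1 *[o] (x3 *[o'] x2)
  | x2x3_x1 => (x2 *[o'] x3) *[o] x1
  | x3x2_x1 => (x3 *[o'] x2) *[o] x1
  | x2_x1x3 => x2 *[o] (x1 *[o'] x3)
  | x2_x3x1 => x2 *[o] (x3 *[o'] x1)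
  | x1x3_x2 => (x1 *[o'] x3) *[o] x2
  | x3x1_x2 => (x3 *[o'] x1) *[o] x2
  end.

Local Notation x := (Var 0%nat).
Local Notation y := (Var 1%nat).
Local Notation z := (Var 2%nat).

Record mci := Mci {
  sg :> signature;
  ident : term sg nat -> term sg nat -> Prop;
  id_addA : ident (x + (y + z))%T ((x + y) + z)%T;
  id_add0x : ident (0 + x)%T x;
  id_addx0 : ident (x + 0)%T x;
  id_addNx : ident (- x + x)%T 0%T;
  id_addxN : ident (x + - x)%T 0%T;
  id_dual : forall o, ident (x *[dual o] y)%T (y *[o] x)%T;
  id_binD : forall o, ident (x *[o] (y + z))%T (x *[o] y + x *[o] z)%T;
  id_unaD : forall w, ident (TUna w (x + y)%T) (TUna w x + TUna w y)%T;
  id_unaM : forall w o,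
    ident (TUna w (x *[o] y)%T) (TUna w x *[o] TUna w y)%T;
  axiom1 : forall A : algebra sg, models ident A ->
    forall (o : bin_op sg) (x1 x2 x3 : A),
      x1 + (x2 *[o] x3) = (x2 *[o] x3) + x1;
  axiom2 : forall o o' : bin_op sg,
    exists W : term sg (shape * bin_op sg * bin_op sg),
    forall A : algebra sg, models ident A -> forall x1 x2 x3 : A,
      (x1 *[o] x2) *[o'] x3 = eval (shape_val x1 x2 x3) W
}.

Record object (T : mci) := Object {
  alg :> algebra T;
  alg_models : models (@ident T) alg
}.

Record hom (T : mci) (A B : object T) := Hom {
  hom_fun :> A -> B;
  hom0 : hom_fun 0 = 0;
  homN : forall a, hom_fun (- a) = - hom_fun a;
  homD : forall a b, hom_fun (a + b) = hom_fun a + hom_fun b;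
  homU : forall w a, hom_fun (una w a) = una w (hom_fun a);
  homB : forall o a b, hom_fun (a *[o] b) = hom_fun a *[o] hom_fun b
}.

Section Identities.
Variables (T : mci) (A : object T).
Implicit Types a b c : A.

Let env a b c (n : nat) : A :=
  match n with 0%nat => a | 1%nat => b | _ => c end.

Lemma addA a b c : a + (b + c) = (a + b) + c.
Proof. exact: (alg_models (id_addA T) (env a b c)). Qed.
Lemma add0x a : 0 + a = a.
Proof. exact: (alg_models (id_add0x T) (env a a a)). Qed.
Lemma addx0 a : a + 0 = a.
Proof. exact: (alg_models (id_addx0 T) (env a a a)). Qed.
Lemma addNx a : - a + a = 0.
Proof. exact: (alg_models (id_addNx T) (env a a a)). Qed.
Lemma addxN a : a - a = 0.
Proof. exact: (alg_models (id_addxN T) (env a a a)). Qed.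
Lemma dualE o a b : a *[dual o] b = b *[o] a.
Proof. exact: (alg_models (id_dual o) (env a b b)). Qed.
Lemma binDr o a b c : a *[o] (b + c) = a *[o] b + a *[o] c.
Proof. exact: (alg_models (id_binD o) (env a b c)). Qed.
Lemma unaD (w : una_op T) a b : una w (a + b) = una w a + una w b.
Proof. exact: (alg_models (id_unaD w) (env a b b)). Qed.
Lemma unaM (w : una_op T) o a b : una w (a *[o] b) = una w a *[o] una w b.
Proof. exact: (alg_models (id_unaM w o) (env a b b)). Qed.

Lemma addxI a b c : a + b = a + c -> b = c.
Proof. by move=> e; rewrite -(add0x b) -(addNx a) -addA e addA addNx add0x. Qed.

Lemma addIx a b c : b + a = c + a -> b = c.
Proof. by move=> e; rewrite -(addx0 b) -(addxN a) addA e -addA addxN addx0. Qed.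

Lemma opp0 : - 0 = 0 :> A.
Proof. by rewrite -[LHS]add0x addxN. Qed.

Lemma una0 (w : una_op T) : una w 0 = 0 :> A.
Proof. by apply: (@addxI (una w 0)); rewrite -unaD !addx0. Qed.

Lemma bin0r o a : a *[o] 0 = 0.
Proof. by apply: (@addxI (a *[o] 0)); rewrite -binDr !addx0. Qed.

Lemma bin0l o a : 0 *[o] a = 0.
Proof. by rewrite -dualE bin0r. Qed.

Lemma binDl o a b c : (a + b) *[o] c = a *[o] c + b *[o] c.
Proof. by rewrite -!(dualE o c) binDr. Qed.

Lemma binNr o a b : a *[o] (- b) = - (a *[o] b).
Proof. by apply: (@addxI (a *[o] b)); rewrite -binDr !addxN bin0r. Qed.
End Identities.

Section Constructions.
Variable T : mci.

Section Product.
Variables A B : object T.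

Definition prod_alg : algebra T := {|
  carrier := (A * B)%type;
  zero := (0, 0);
  opp := fun p => (- p.1, - p.2);
  add := fun p q => (p.1 + q.1, p.2 + q.2);
  una := fun w p => (una w p.1, una w p.2);
  bin := fun o p q => (p.1 *[o] q.1, p.2 *[o] q.2)
|}.

Lemma prod_models : models (@ident T) prod_alg.
Proof.
move=> t u h e.
have ev (s : term T nat) :
    eval e s = (eval (fun n => (e n).1) s, eval (fun n => (e n).2) s).
{ elim: s => /=.
  - by move=> v; case: (e v).
  - by [].
  - by move=> s ->.
  - by move=> s -> s' ->.
  - by move=> w s ->.
  - by move=> o s -> s' ->. }
by rewrite !ev !(alg_models h).
Qed.

Definition prod_obj : object T := Object prod_models.
End Product.

Section Subobject.
Variables (A : object T) (P : A -> Prop).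

Record op_closed : Prop := OpClosed {
  closed0 : P 0;
  closedN : forall a, P a -> P (- a);
  closedD : forall a b, P a -> P b -> P (a + b);
  closedU : forall w a, P a -> P (una w a);
  closedB : forall o a b, P a -> P b -> P (a *[o] b)
}.

Hypothesis clP : op_closed.

Definition sub_alg : algebra T := {|
  carrier := {a : A | P a};
  zero := exist _ 0 (closed0 clP);
  opp := fun a => exist _ (- proj1_sig a) (closedN clP (proj2_sig a));
  add := fun a b => exist _ (proj1_sig a + proj1_sig b)
                          (closedD clP (proj2_sig a) (proj2_sig b));
  una := fun w a => exist _ (una w (proj1_sig a))
                          (closedU clP w (proj2_sig a));
  bin := fun o a b => exist _ (proj1_sig a *[o] proj1_sig b)
                            (closedB clP o (proj2_sig a) (proj2_sig b))
|}.

Lemma sub_val_inj (a b : {a : A | P a}) : proj1_sig a = proj1_sig b -> a = b.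
Proof.
case: a b => [a ha] [b hb] /= e; subst b.
by rewrite (proof_irrelevance _ ha hb).
Qed.

Lemma sub_models : models (@ident T) sub_alg.
Proof.
move=> t u h e; apply: sub_val_inj.
have ev (s : term T nat) :
    proj1_sig (eval e s) = eval (fun n => proj1_sig (e n)) s.
{ elim: s => //=.
  - by move=> s ->.
  - by move=> s -> s' ->.
  - by move=> w s ->.
  - by move=> o s -> s' ->. }
by rewrite !ev (alg_models h).
Qed.

Definition sub_obj : object T := Object sub_models.

Definition sub_incl : hom sub_obj A :=
  @Hom T sub_obj A (@proj1_sig A P) eq_refl (fun _ => eq_refl)
    (fun _ _ => eq_refl) (fun _ _ => eq_refl) (fun _ _ _ => eq_refl).
End Subobject.

Record split_ext (A B : object T) := SplitExt {
  se_mid : object T;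
  se_i : hom A se_mid;
  se_p : hom se_mid B;
  se_s : hom B se_mid;
  se_inj : forall a a', se_i a = se_i a' -> a = a';
  se_ker : forall e, se_p e = 0 <-> exists a, se_i a = e;
  se_sec : forall b, se_p (se_s b) = b
}.

Definition derived_action (A B : object T)
    (dot : B -> A -> A) (star : bin_op T -> B -> A -> A) : Prop :=
  exists X : split_ext A B,
    (forall b a, se_i X (dot b a) = se_s X b + se_i X a - se_s X b) /\
    (forall o b a, se_i X (star o b a) = se_s X b *[o] se_i X a).
End Constructions.

Record xmod (T : mci) := Xmod {
  top : object T;
  base : object T;
  dot : base -> top -> top;
  star : bin_op T -> base -> top -> top;
  act_derived : derived_action dot star;
  bd : hom top base;
  bd_dot : forall c0 c1, bd (dot c0 c1) = c0 + bd c1 - c0;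
  bd_star : forall o c0 c1, bd (star o c0 c1) = c0 *[o] bd c1;
  dot_bd : forall c1 c1', dot (bd c1) c1' = c1 + c1' - c1;
  star_bd : forall o c1 c1', star o (bd c1) c1' = c1 *[o] c1'
}.

Arguments bd {T x}.

(* The product of an element of [top] by one of [base], in this order. *)
Definition rstar (T : mci) (C : xmod T) (o : bin_op T)
    (c1 : top C) (c0 : base C) : top C := star (dual o) c0 c1.

Record xhom (T : mci) (C D : xmod T) := Xhom {
  htop : hom (top C) (top D);
  hbase : hom (base C) (base D);
  hbd : forall c1, hbase (bd c1) = bd (htop c1);
  hdot : forall c0 c1, htop (dot c0 c1) = dot (hbase c0) (htop c1);
  hstar : forall o c0 c1, htop (star o c0 c1) = star o (hbase c0) (htop c1)
}.

Definition xhom_eq (T : mci) (C D : xmod T) (f g : xhom C D) : Prop :=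
  (forall c1, htop f c1 = htop g c1) /\ (forall c0, hbase f c0 = hbase g c0).

Section XmodCategory.
Variable T : mci.

Definition hom_id (A : object T) : hom A A :=
  @Hom T A A (fun a => a) eq_refl (fun _ => eq_refl)
    (fun _ _ => eq_refl) (fun _ _ => eq_refl) (fun _ _ _ => eq_refl).

Definition hom_comp (A B C : object T) (g : hom B C) (f : hom A B) : hom A C.
Proof.
apply: (@Hom T A C (fun a => g (f a))).
- by rewrite !hom0.
- by move=> a; rewrite !homN.
- by move=> a b; rewrite !homD.
- by move=> w a; rewrite !homU.
- by move=> o a b; rewrite !homB.
Defined.

Definition xid (C : xmod T) : xhom C C :=
  @Xhom T C C (hom_id (top C)) (hom_id (base C)) (fun _ => eq_refl)
    (fun _ _ => eq_refl) (fun _ _ _ => eq_refl).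

Definition xcomp (B C D : xmod T) (g : xhom C D) (f : xhom B C) : xhom B D.
Proof.
apply: (@Xhom T B D (hom_comp (htop g) (htop f)) (hom_comp (hbase g) (hbase f))).
- by move=> c1 /=; rewrite !hbd.
- by move=> c0 c1 /=; rewrite !hdot.
- by move=> o c0 c1 /=; rewrite !hstar.
Defined.

Lemma dotx0 (C : xmod T) (c0 : base C) : dot c0 0 = 0 :> top C.
Proof.
case: (act_derived C) => X [hd _]; apply: (se_inj (s := X)).
by rewrite hd hom0 addx0 addxN.
Qed.

Lemma dot0x (C : xmod T) (c1 : top C) : dot 0 c1 = c1.
Proof.
case: (act_derived C) => X [hd _]; apply: (se_inj (s := X)).
by rewrite hd hom0 add0x opp0 addx0.
Qed.

Lemma dotxD (C : xmod T) (c0 : base C) (a b : top C) :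
  dot c0 (a + b) = dot c0 a + dot c0 b.
Proof.
case: (act_derived C) => X [hd _]; apply: (se_inj (s := X)).
by rewrite homD !hd homD -!addA (addA (- se_s X c0)) addNx add0x.
Qed.

Lemma dotDx (C : xmod T) (a b : base C) (c1 : top C) :
  dot (a + b) c1 = dot a (dot b c1).
Proof.
case: (act_derived C) => X [hd _]; apply: (se_inj (s := X)).
rewrite !hd homD -!addA; do 3 congr (_ + _).
apply: (@addxI _ _ (se_s X a + se_s X b)).
by rewrite addxN -addA (addA (se_s X b)) addxN add0x addxN.
Qed.

Lemma starx0 (C : xmod T) o (c0 : base C) : star o c0 0 = 0 :> top C.
Proof.
case: (act_derived C) => X [_ hs]; apply: (se_inj (s := X)).
by rewrite hs hom0 bin0r.
Qed.

Lemma star0x (C : xmod T) o (c1 : top C) : star o 0 c1 = 0.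
Proof.
case: (act_derived C) => X [_ hs]; apply: (se_inj (s := X)).
by rewrite hs !hom0 bin0l.
Qed.

Lemma starxD (C : xmod T) o (c0 : base C) (a b : top C) :
  star o c0 (a + b) = star o c0 a + star o c0 b.
Proof.
case: (act_derived C) => X [_ hs]; apply: (se_inj (s := X)).
by rewrite hs !homD !hs binDr.
Qed.

Lemma starDx (C : xmod T) o (a b : base C) (c1 : top C) :
  star o (a + b) c1 = star o a c1 + star o b c1.
Proof.
case: (act_derived C) => X [_ hs]; apply: (se_inj (s := X)).
by rewrite hs !homD !hs binDl.
Qed.

Section XProduct.
Variables C D : xmod T.

Definition xprod_dot (b : prod_obj (base C) (base D))
    (a : prod_obj (top C) (top D)) : prod_obj (top C) (top D) :=
  (dot b.1 a.1, dot b.2 a.2).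

Definition xprod_star (o : bin_op T) (b : prod_obj (base C) (base D))
    (a : prod_obj (top C) (top D)) : prod_obj (top C) (top D) :=
  (star o b.1 a.1, star o b.2 a.2).

Definition hom_prod (A B A' B' : object T) (f : hom A B) (g : hom A' B') :
  hom (prod_obj A A') (prod_obj B B').
Proof.
apply: (@Hom T (prod_obj A A') (prod_obj B B') (fun p => (f p.1, g p.2))).
- by rewrite /= !hom0.
- by move=> a /=; rewrite !homN.
- by move=> a b /=; rewrite !homD.
- by move=> w a /=; rewrite !homU.
- by move=> o a b /=; rewrite !homB.
Defined.

Lemma xprod_derived : derived_action xprod_dot xprod_star.
Proof.
case: (act_derived C) (act_derived D) => X [hd hs] [Y [kd ks]].
pose i := hom_prod (se_i X) (se_i Y).
pose p := hom_prod (se_p X) (se_p Y).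
pose s := hom_prod (se_s X) (se_s Y).
have inj a a' : i a = i a' -> a = a'.
  case: a a' => [a b] [a' b'] [/se_inj -> e].
  by rewrite (se_inj e).
have ker e : p e = 0 <-> exists a, i a = e.
  case: e => [e1 e2]; split.
    case=> /se_ker [a <-] /se_ker [b <-].
    by exists (a, b).
  case=> -[a b] [<- <-]; congr pair; apply/se_ker.
    by exists a.
  by exists b.
have sec b : p (s b) = b by case: b => b b'; rewrite /p /s /= !se_sec.
exists (SplitExt inj ker sec); split=> /=.
  by move=> b a; rewrite hd kd.
by move=> o b a; rewrite hs ks.
Qed.

Definition xprod : xmod T.
Proof.
apply: (@Xmod T _ _ _ _ xprod_derived (hom_prod (bd (x := C)) (bd (x := D)))).
- by move=> c0 c1 /=; rewrite !bd_dot.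
- by move=> o c0 c1 /=; rewrite !bd_star.
- by move=> c0 c1; rewrite /xprod_dot /= !dot_bd.
- by move=> o c0 c1; rewrite /xprod_star /= !star_bd.
Defined.

Definition hom_inl (A B : object T) : hom A (prod_obj A B).
Proof.
apply: (@Hom T A (prod_obj A B) (fun a => (a, 0))) => //=.
- by move=> a; rewrite opp0.
- by move=> a b; rewrite addx0.
- by move=> w a; rewrite una0.
- by move=> o a b; rewrite bin0r.
Defined.

Definition hom_inr (A B : object T) : hom B (prod_obj A B).
Proof.
apply: (@Hom T B (prod_obj A B) (fun b => (0, b))) => //=.
- by move=> a; rewrite opp0.
- by move=> a b; rewrite addx0.
- by move=> w a; rewrite una0.
- by move=> o a b; rewrite bin0r.
Defined.

Definition xinl : xhom C xprod.
Proof.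
apply: (@Xhom T C xprod (hom_inl (top C) (top D)) (hom_inl (base C) (base D))).
- by move=> c1 /=; rewrite hom0.
- by move=> c0 c1; rewrite /= /xprod_dot /= dotx0.
- by move=> o c0 c1; rewrite /= /xprod_star /= starx0.
Defined.

Definition xinr : xhom D xprod.
Proof.
apply: (@Xhom T D xprod (hom_inr (top C) (top D)) (hom_inr (base C) (base D))).
- by move=> c1 /=; rewrite hom0.
- by move=> c0 c1; rewrite /= /xprod_dot /= dotx0.
- by move=> o c0 c1; rewrite /= /xprod_star /= starx0.
Defined.
End XProduct.

Definition commute (B1 B2 A : xmod T) (b1 : xhom B1 A) (b2 : xhom B2 A) : Prop :=
  exists h : xhom (xprod B1 B2) A,
    xhom_eq (xcomp h (xinl B1 B2)) b1 /\ xhom_eq (xcomp h (xinr B1 B2)) b2.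

Definition central (B A : xmod T) (b : xhom B A) : Prop := commute b (xid A).

Definition mono (B A : xmod T) (b : xhom B A) : Prop :=
  forall (X : xmod T) (f g : xhom X B),
    xhom_eq (xcomp b f) (xcomp b g) -> xhom_eq f g.

Definition central_subobject (B A : xmod T) (b : xhom B A) : Prop :=
  mono b /\ central b.

Definition factors_through (B B' A : xmod T) (b : xhom B A) (b' : xhom B' A) :
    Prop :=
  exists f : xhom B B', xhom_eq (xcomp b' f) b.

Definition maximal_central_subobject (Z A : xmod T) (i : xhom Z A) : Prop :=
  central_subobject i /\
  forall (B : xmod T) (b : xhom B A),
    central_subobject b -> factors_through b i.

Section Center.
Variable C : xmod T.

Definition Z1 (z1 : top C) : Prop :=
  (forall c1 : top C, z1 + c1 = c1 + z1) /\
  (forall c0 : base C, c0 + bd z1 = bd z1 + c0) /\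
  (forall c0 : base C, dot c0 z1 = z1) /\
  (forall o (c1 : top C), c1 *[o] z1 = 0) /\
  (forall o (c0 : base C), star o c0 z1 = 0).

Definition Z0 (z0 : base C) : Prop :=
  (forall c1 : top C, dot z0 c1 = c1) /\
  (forall c0 : base C, z0 + c0 = c0 + z0) /\
  (forall o (c1 : top C), rstar o c1 z0 = 0) /\
  (forall o (c0 : base C), c0 *[o] z0 = 0).

(* The remaining operations always preserve [Z1] and [Z0] ([Z1_closed],
   [Z0_closed]).  An operation of Omega_1' need not: for groups with an
   endomorphism w and [top C] trivial, [Z0] is the center of the group, which w
   may fail to preserve, and then no crossed submodule has it as its base. *)
Definition unary_stable : Prop :=
  (forall (w : una_op T) z1, Z1 z1 -> Z1 (una w z1)) /\
  (forall (w : una_op T) z0, Z0 z0 -> Z0 (una w z0)).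

Lemma comm_opp (A : object T) (a : A) :
  (forall b, a + b = b + a) -> forall b, - a + b = b - a.
Proof.
move=> h b; apply: (@addxI _ _ a).
by rewrite addA addxN add0x h -addA addNx addx0.
Qed.

Lemma comm_add (A : object T) (a a' : A) :
  (forall b, a + b = b + a) -> (forall b, a' + b = b + a') ->
  forall b, (a + a') + b = b + (a + a').
Proof. by move=> h h' b; rewrite -addA h' addA h addA. Qed.

Lemma dotxN (c0 : base C) (a : top C) : dot c0 (- a) = - dot c0 a.
Proof. by apply: (@addxI _ _ (dot c0 a)); rewrite -dotxD !addxN dotx0. Qed.

Lemma starxN o (c0 : base C) (a : top C) : star o c0 (- a) = - star o c0 a.
Proof. by apply: (@addxI _ _ (star o c0 a)); rewrite -starxD !addxN starx0. Qed.

Lemma Z1_0 : Z1 0.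
Proof.
split; first by move=> c; rewrite add0x addx0.
split; first by move=> c; rewrite hom0 add0x addx0.
split; first exact: dotx0.
by split; [exact: bin0r | exact: starx0].
Qed.

Lemma Z0_0 : Z0 0.
Proof.
split; first exact: dot0x.
split; first by move=> c; rewrite add0x addx0.
by split; [move=> o c; exact: star0x | exact: bin0r].
Qed.

Lemma Z1_closed : unary_stable -> op_closed Z1.
Proof.
case=> hU _; split.
- exact: Z1_0.
- move=> a [h1 [h2 [h3 [h4 h5]]]].
  split; first exact: comm_opp.
  split; first by move=> c; rewrite homN comm_opp // => b; rewrite h2.
  split; first by move=> c; rewrite dotxN h3.
  by split=> o c; rewrite ?binNr ?starxN ?h4 ?h5 opp0.
- move=> a b [h1 [h2 [h3 [h4 h5]]]] [k1 [k2 [k3 [k4 k5]]]].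
  split; first exact: comm_add.
  split; first by move=> c; rewrite homD -comm_add // => d; rewrite ?h2 ?k2.
  split; first by move=> c; rewrite dotxD h3 k3.
  by split=> o c; rewrite ?binDr ?starxD ?h4 ?h5 ?k4 ?k5 addx0.
- exact: hU.
- by move=> o a b _ [_ [_ [_ [h _]]]]; rewrite h; exact: Z1_0.
Qed.

Lemma Z0_closed : unary_stable -> op_closed Z0.
Proof.
case=> _ hU; split.
- exact: Z0_0.
- move=> a [h1 [h2 [h3 h4]]].
  split; first by move=> c; rewrite -{1}(h1 c) -dotDx addNx dot0x.
  split; first exact: comm_opp.
  split=> o c; last by rewrite binNr h4 opp0.
  rewrite /rstar; apply: (@addxI _ _ (star (dual o) a c)).
  by rewrite -starDx addxN star0x addx0 [star _ _ _]h3.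
- move=> a b [h1 [h2 [h3 h4]]] [k1 [k2 [k3 k4]]].
  split; first by move=> c; rewrite dotDx k1 h1.
  split; first exact: comm_add.
  split=> o c; last by rewrite binDr h4 k4 addx0.
  by rewrite /rstar starDx [star _ a c]h3 [star _ b c]k3 addx0.
- exact: hU.
- by move=> o a b _ [_ [_ [_ h]]]; rewrite h; exact: Z0_0.
Qed.

Lemma Z1_bd a : Z1 a -> Z0 (bd a).
Proof.
move=> [h1 [h2 [h3 [h4 h5]]]].
split; first by move=> c; rewrite dot_bd h1 -addA addxN addx0.
split; first by move=> c; rewrite h2.
split=> o c; first by rewrite /rstar star_bd dualE h4.
by rewrite -bd_star h5 hom0.
Qed.

Lemma Z1_dot c a : Z1 a -> Z1 (dot c a).
Proof. by move=> h; case: (h) => [_ [_ [-> _]]]. Qed.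

Lemma Z1_star o c a : Z1 a -> Z1 (star o c a).
Proof. by case=> [_ [_ [_ [_ ->]]]]; exact: Z1_0. Qed.

Hypothesis st : unary_stable.

Definition Z1_obj : object T := sub_obj (Z1_closed st).
Definition Z0_obj : object T := sub_obj (Z0_closed st).

Definition center_dot (b : Z0_obj) (a : Z1_obj) : Z1_obj :=
  exist _ (dot (proj1_sig b) (proj1_sig a))
        (Z1_dot (proj1_sig b) (proj2_sig a)).

Definition center_star (o : bin_op T) (b : Z0_obj) (a : Z1_obj) : Z1_obj :=
  exist _ (star o (proj1_sig b) (proj1_sig a))
        (Z1_star o (proj1_sig b) (proj2_sig a)).

Definition center_bd : hom Z1_obj Z0_obj.
Proof.
apply: (@Hom T Z1_obj Z0_obj
  (fun a => exist _ (bd (proj1_sig a)) (Z1_bd (proj2_sig a)))).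
- by apply: sub_val_inj; rewrite /= hom0.
- by move=> a; apply: sub_val_inj; rewrite /= homN.
- by move=> a b; apply: sub_val_inj; rewrite /= homD.
- by move=> w a; apply: sub_val_inj; rewrite /= homU.
- by move=> o a b; apply: sub_val_inj; rewrite /= homB.
Defined.

Definition hom_snd (A B : object T) : hom (prod_obj A B) B :=
  @Hom T (prod_obj A B) B (fun p => p.2) eq_refl (fun _ => eq_refl)
    (fun _ _ => eq_refl) (fun _ _ => eq_refl) (fun _ _ _ => eq_refl).

Lemma center_derived : derived_action center_dot center_star.
Proof.
pose i := hom_inl Z1_obj Z0_obj; pose p := hom_snd Z1_obj Z0_obj.
pose s := hom_inr Z1_obj Z0_obj.
have inj a a' : i a = i a' -> a = a' by case.
have ker e : p e = 0 <-> exists a, i a = e.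
  case: e => [a b]; split=> [e | [a' [_ <-]] //].
  by exists a; congr pair; exact: esym e.
have sec b : p (s b) = b by [].
exists (SplitExt inj ker sec); split.
- move=> b a.
  change ((center_dot b a, 0 : Z0_obj) =
          (0 + a - 0 : Z1_obj, b + 0 - b : Z0_obj)).
  rewrite opp0 !addx0 add0x addxN; congr pair; apply: sub_val_inj.
  by case: (proj2_sig a) => [_ [_ [h _]]]; exact: h.
- move=> o b a.
  change ((center_star o b a, 0 : Z0_obj) = ((0 : Z1_obj) *[o] a, b *[o] 0)).
  rewrite bin0l bin0r; congr pair; apply: sub_val_inj.
  by case: (proj2_sig a) => [_ [_ [_ [_ h]]]]; exact: h.
Qed.

Definition center : xmod T.
Proof.
apply: (@Xmod T Z1_obj Z0_obj center_dot center_star center_derived center_bd).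
- by move=> c0 c1; apply: sub_val_inj; exact: bd_dot.
- by move=> o c0 c1; apply: sub_val_inj; exact: bd_star.
- by move=> c0 c1; apply: sub_val_inj; exact: dot_bd.
- by move=> o c0 c1; apply: sub_val_inj; exact: star_bd.
Defined.

Definition center_incl : xhom center C :=
  @Xhom T center C (sub_incl (Z1_closed st)) (sub_incl (Z0_closed st))
    (fun _ => eq_refl) (fun _ _ => eq_refl) (fun _ _ _ => eq_refl).
End Center.
End XmodCategory.

(* Main.v *)
(* The center commutes with the identity through addition: the elements of the
   center annihilate every product and commute with everything, so that
   [(z, c) |-> z + c] preserves all operations.  Conversely, if [h] exhibits [b]
   as central, every operation mixing [b x = h (x, 0)] and [c = h (0, c)] can be
   computed in the product, where the mixed terms are trivial; hence the image
   of [b] lies in the center. *)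
From Corelib Require Import ssreflect ssrfun.
Require Import Defs.

Set Implicit Arguments.
Unset Strict Implicit.
Unset Printing Implicit Defensive.

Local Open Scope alg_scope.

Section SubobjectLift.
Variables (T : mci) (A B : object T) (P : A -> Prop) (clP : op_closed P).
Variables (f : hom B A) (fP : forall b, P (f b)).

Definition sub_lift : hom B (sub_obj clP).
Proof.
apply: (@Hom T B (sub_obj clP) (fun b => exist _ (f b) (fP b))).
- by apply: sub_val_inj; rewrite /= hom0.
- by move=> a; apply: sub_val_inj; rewrite /= homN.
- by move=> a b; apply: sub_val_inj; rewrite /= homD.
- by move=> w a; apply: sub_val_inj; rewrite /= homU.
- by move=> o a b; apply: sub_val_inj; rewrite /= homB.
Defined.
End SubobjectLift.

Section CentralAddition.
Variables (T : mci) (A B : object T) (f : hom B A).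
Hypothesis f_comm : forall b a, f b + a = a + f b.
Hypothesis f_ann : forall o a b, a *[o] f b = 0.

Lemma central_annl o a b : f b *[o] a = 0.
Proof. by rewrite -dualE f_ann. Qed.

Definition central_add : hom (prod_obj B A) A.
Proof.
apply: (@Hom T (prod_obj B A) A (fun p => f p.1 + p.2)).
- by rewrite /= hom0 addx0.
- move=> p /=; apply: (@addxI _ _ (f p.1 + p.2)).
  by rewrite addxN f_comm homN -addA (addA (f p.1)) addxN add0x addxN.
- move=> p q /=.
  by rewrite homD -!addA; congr (_ + _); rewrite !addA f_comm.
- by move=> w p /=; rewrite homU unaD.
(* Even [f p.1 *[o] f q.1] vanishes, so both sides collapse to [p.2 *[o] q.2]. *)
- by move=> o p q /=; rewrite homB binDl !binDr !central_annl f_ann !add0x.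
Defined.
End CentralAddition.

Section CentralMorphisms.
Variables (T : mci) (C : xmod T).

(* [dual] need not be involutive on operation symbols, only on their
   interpretations. *)
Lemma star_dualK o (c0 : base C) (c1 : top C) :
  star (dual (dual o)) c0 c1 = star o c0 c1.
Proof.
case: (act_derived C) => X [_ hs]; apply: (se_inj (s := X)).
by rewrite !hs !dualE.
Qed.

(** Through [rstar], [Z0] constrains only the operations [star (dual o)]; since [o] acts as the dual
    of [dual o], every operation is reached. *)
Lemma Z0_star o (z0 : base C) (c1 : top C) : Z0 z0 -> star o z0 c1 = 0.
Proof. by move=> [_ [_ [h _]]]; rewrite -star_dualK; exact: h. Qed.

Section CenterAddition.
Variable st : unary_stable C.

Lemma center_top_comm (z : Z1_obj st) (c : top C) :
  sub_incl (Z1_closed st) z + c = c + sub_incl (Z1_closed st) z.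
Proof. by case: (proj2_sig z). Qed.

Lemma center_top_ann o (c : top C) (z : Z1_obj st) :
  c *[o] sub_incl (Z1_closed st) z = 0.
Proof. by case: (proj2_sig z) => [_ [_ [_ [h _]]]]; exact: h. Qed.

Lemma center_base_comm (z : Z0_obj st) (c : base C) :
  sub_incl (Z0_closed st) z + c = c + sub_incl (Z0_closed st) z.
Proof. by case: (proj2_sig z) => [_ [h _]]; exact: h. Qed.

Lemma center_base_ann o (c : base C) (z : Z0_obj st) :
  c *[o] sub_incl (Z0_closed st) z = 0.
Proof. by case: (proj2_sig z) => [_ [_ [_ h]]]; exact: h. Qed.

Definition center_add : xhom (xprod (center st) C) C.
Proof.
apply: (@Xhom T (xprod (center st) C) C
  (central_add center_top_comm center_top_ann)
  (central_add center_base_comm center_base_ann)).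
- by move=> [z1 c1] /=; rewrite homD.
- move=> [[z0 hz0] c0] [[z1 hz1] c1] /=.
  have [hdot0 _] := hz0; have [_ [_ [hdot1 _]]] := hz1.
  (* [z0] acts trivially on all of [top C] and every [c0] fixes [z1], so both sides equal
     [z1 + dot c0 c1]. *)
  by rewrite dotDx !hdot0 dotxD hdot1.
- move=> o [[z0 hz0] c0] [[z1 hz1] c1] /=.
  have [_ [_ [_ [_ hstar1]]]] := hz1.
  (* Every term containing [z0] or [z1] vanishes; only [star o c0 c1] survives on either side. *)
  by rewrite starDx !(Z0_star _ _ hz0) starxD hstar1 !add0x.
Defined.

Lemma center_central : central (center_incl st).
Proof.
exists center_add; split; split=> c /=; by rewrite ?addx0 ?add0x.
Qed.

Lemma center_mono : mono (center_incl st).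
Proof.
move=> X f g [e1 e0]; split=> c; apply: sub_val_inj.
  exact: e1.
exact: e0.
Qed.
End CenterAddition.

Section CentralImage.
Variables (B : xmod T) (b : xhom B C).
Hypothesis bC : central b.

(** Holds because [(x, 0)] and [(0, c)] commute in the product. It serves [Z0] directly, and [Z1]
    through the condition on [bd z1]. *)
Lemma central_base_comm (x : base B) (c : base C) :
  hbase b x + c = c + hbase b x.
Proof.
have [h [[_ l0] [_ r0]]] := bC.
rewrite -(l0 x) -[c](r0 c) /= -!homD; congr (hbase h _).
by rewrite /= !addx0 !add0x.
Qed.

Lemma central_top_Z1 (x : top B) : Z1 (htop b x).
Proof.
have [h [[l1 l0] [r1 r0]]] := bC.
split.
  move=> c; rewrite -(l1 x) -[c](r1 c) /= -!homD; congr (htop h _).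
  by rewrite /= !addx0 !add0x.
(* The boundary of [htop b x] is [hbase b (bd x)], again in the image of the base. *)
split; first by move=> c; rewrite -hbd central_base_comm.
split.
  (* In the product, [(0, c)] sends [(x, 0)] to [(dot 0 x, dot c 0)], which is [(x, 0)]. *)
  move=> c; rewrite -(l1 x) -[c](r0 c) /= -(hdot h (0, c) (x, 0)); congr (htop h _).
  by rewrite /= /xprod_dot /= dot0x dotx0.
split=> o c; rewrite -(l1 x).
  (* The right-hand zero is written as the image of [0] under [h], so that the equation can be
     checked in the product. *)
  rewrite -[c](r1 c) /= -homB -[RHS](hom0 (htop h)); congr (htop h _).
  by rewrite /= bin0l bin0r.
rewrite -[c](r0 c) /= -(hstar h o (0, c) (x, 0)) -[RHS](hom0 (htop h)); congr (htop h _).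
by rewrite /= /xprod_star /= star0x starx0.
Qed.

Lemma central_base_Z0 (x : base B) : Z0 (hbase b x).
Proof.
have [h [[l1 l0] [r1 r0]]] := bC.
split.
  move=> c; rewrite -(l0 x) -[c](r1 c) /= -(hdot h (x, 0) (0, c)); congr (htop h _).
  by rewrite /= /xprod_dot /= dot0x dotx0.
split; first exact: central_base_comm.
split=> o c; rewrite -(l0 x).
  rewrite /rstar -[c](r1 c) /= -(hstar h _ (x, 0) (0, c)) -[RHS](hom0 (htop h)).
  congr (htop h _).
  by rewrite /= /xprod_star /= star0x starx0.
rewrite -[c](r0 c) /= -homB -[RHS](hom0 (hbase h)); congr (hbase h _).
by rewrite /= bin0l bin0r.
Qed.

(** The factorization is [b] with its codomain restricted to the center; its laws are those of [b]
    read on underlying elements. *)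
Lemma central_factors (st : unary_stable C) :
  factors_through b (center_incl st).
Proof.
unshelve eexists (@Xhom T B (center st)
  (sub_lift (Z1_closed st) central_top_Z1)
  (sub_lift (Z0_closed st) central_base_Z0) _ _ _).
- by move=> x; apply: sub_val_inj; rewrite /= hbd.
- by move=> c x; apply: sub_val_inj; rewrite /= hdot.
- by move=> o c x; apply: sub_val_inj; rewrite /= hstar.
- by [].
Qed.
End CentralImage.
End CentralMorphisms.

Theorem proposition30 (T : mci) (C : xmod T) (st : unary_stable C) :
  maximal_central_subobject (center_incl st).
Proof.
split; first by split; [exact: center_mono | exact: center_central].
by move=> B b [_ bC]; exact: central_factors.
Qed.
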